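(* Let $X$ be a locally convex space and let $T:X\rightrightarrows X^{*}$. The following are equivalent: (i) $T\in\mathcal{M}(X)$ and $T$ is identifiable; (ii) $T$ is representable and locatable; (iii) $T$ is representable and locally-NI; (iv) $T$ is monotone, low-representable, and locatable; (v) $T$ is monotone, low-representable, and locally-NI.
   Context: Throughout, $(X,\tau)$ is a non-trivial Hausdorff locally convex space, $X^{*}$ its dual with weak-star topology $\omega^{*}$, $Z:=X\times X^{*}$ with topology $\tau\times\omega^{*}$, $c(x,x^{*})=\langle x,x^{*}\rangle$. An operator $T:X\rightrightarrows X^*$ is identified with its graph; $D(T)$ is its domain; $T|_{V}$ has graph $\operatorname{Graph}T\cap(V\times X^{*})$. For $f,g:Z\to\overline{\mathbb R}$, $[f\le g]=\{z\mid f(z)\le g(z)\}$, etc. $\varphi_{T}(x,x^{*})=\sup\{\langle x,u^{*}\rangle+\langle u,x^{*}\rangle-\langle u,u^{*}\rangle\mid(u,u^{*})\in T\}$ ($\sup\emptyset=-\infty$); $\psi_T$ is the $\tau\times\omega^*$-lsc convex hull of $c+\iota_{\operatorname{Graph}T}$. $\mathcal{M}(X)$: monotone operators with non-empty graph. $\mathscr{R}$: proper convex $\tau\times\omega^{*}$-lsc $h:Z\to\overline{\mathbb{R}}$ with $h\ge c$. $T$ is $V$-representable ($V\subset X$) if $V\cap D(T)\neq\emptyset$ and there is $h\in\mathscr{R}$ with $[h=c]\cap(V\times X^{*})=\operatorname{Graph}(T|_{V})$; representable means $X$-representable; low-representable means: for every $(x,x^{*})\in[\psi_{T}=c]$ there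 is a neighborhood $V$ of $x$ such that $T$ is $V$-representable. $V$ identifies $T$ if $[\varphi_{T|_{V}}\le c]\cap(V\times X^{*})\subset\operatorname{Graph}T$; $V$ locates $T$ if $\operatorname{Pr}_{X}([\varphi_{T|_{V}}\le c])\cap V\subset D(T)$; $T$ is $V$-NI if $\varphi_{T|_{V}}\ge c$ on $V\times X^{*}$. $T$ is identifiable (resp. locatable, locally-NI) if every open convex $V$ with $V\cap D(T)\neq\emptyset$ identifies $T$ (resp. locates $T$, resp. $T$ is $V$-NI).
   Formalization: In (iv) and (v), ''monotone'' is read as T ∈ M(X), i.e. monotone with non-empty graph, because the empty operator satisfies (iv) and (v) vacuously but not (i)–(iii). *)

(* Defs.v *)
From HB Require Import structures.
From mathcomp Require Import all_boot all_order all_algebra.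
From mathcomp Require Import all_classical all_reals all_analysis.
Set Implicit Arguments. Unset Strict Implicit. Unset Printing Implicit Defensive.
Import Order.TTheory GRing.Theory Num.Theory.
Import numFieldTopology.Exports numFieldNormedType.Exports.
Local Open Scope classical_set_scope.
Local Open Scope ring_scope.

Section Defs.
Variables (R : realType) (X : tvsType R).

Record dual := Dual {
  dfun :> X -> R ;
  dfun_linear : forall (a : R) (x y : X), dfun (a *: x + y) = a * dfun x + dfun y ;
  dfun_cont : continuous dfun }.

(* Z := X x X^* ; an operator is identified with its graph *)
Definition Z := (X * dual)%type.
Definition operator := set Z.

Definition coupling (z : Z) : R := z.2 z.1.

(* open sets of the product topology tau x omega^* on Z *)
Definition Zopen (W : set Z) : Prop :=
  forall z, W z -> exists U : set X, nbhs z.1 U /\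
    exists (s : seq X) (e : R), 0 < e /\
      forall y : Z, U y.1 -> (forall u, u \in s -> `|y.2 u - z.2 u| < e) -> W y.
Definition Zclosed (A : set Z) : Prop := Zopen (~` A).

Definition Zlsc (f : Z -> \bar R) : Prop :=
  forall r : R, Zclosed [set z | (f z <= r%:E)%E].

Definition Zcomb (t : R) (z1 z2 z : Z) : Prop :=
  z.1 = t *: z1.1 + (1 - t) *: z2.1 /\
  forall u, z.2 u = t * z1.2 u + (1 - t) * z2.2 u.

(* convexity of an extended-real valued function (convex epigraph) *)
Definition Zconvex (f : Z -> \bar R) : Prop :=
  forall (z1 z2 z : Z) (t r1 r2 : R), 0 <= t <= 1 -> Zcomb t z1 z2 z ->
    (f z1 <= r1%:E)%E -> (f z2 <= r2%:E)%E -> (f z <= (t * r1 + (1 - t) * r2)%:E)%E.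

Definition Zproper (f : Z -> \bar R) : Prop :=
  (forall z, f z != -oo%E) /\ exists z, f z != +oo%E.

Definition repr_class (h : Z -> \bar R) : Prop :=
  Zproper h /\ Zconvex h /\ Zlsc h /\ forall z, ((coupling z)%:E <= h z)%E.

Definition domain (T : operator) : set X := [set x | exists xs, T (x, xs)].

Definition restrict (T : operator) (V : set X) : operator :=
  T `&` [set z | V z.1].

Definition fitz (T : operator) (z : Z) : \bar R :=
  ereal_sup [set ((u.2 z.1 + z.2 u.1 - u.2 u.1)%:E) | u in T].

Definition c_plus_ind (T : operator) (z : Z) : \bar R :=
  if `[< T z >] then (coupling z)%:E else +oo%E.

(* psi_T : the tau x omega^*-lsc convex hull of c + iota_T, i.e. the largest
   lsc convex minorant *)
Definition psi (T : operator) (z : Z) : \bar R :=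
  ereal_sup [set g z | g in [set g : Z -> \bar R |
     Zconvex g /\ Zlsc g /\ forall w, (g w <= c_plus_ind T w)%E]].

Definition monotone (T : operator) : Prop :=
  forall z w, T z -> T w -> 0 <= z.2 z.1 - z.2 w.1 - w.2 z.1 + w.2 w.1.

Definition in_M (T : operator) : Prop := monotone T /\ T !=set0.

Definition V_representable (T : operator) (V : set X) : Prop :=
  V `&` domain T !=set0 /\
  exists h, repr_class h /\
    [set z | h z = (coupling z)%:E] `&` [set z | V z.1] = restrict T V.

Definition representable (T : operator) : Prop := V_representable T setT.

Definition low_representable (T : operator) : Prop :=
  forall z : Z, psi T z = (coupling z)%:E ->
    exists V : set X, nbhs z.1 V /\ V_representable T V.

Definition identifies (V : set X) (T : operator) : Prop :=
  [set z | (fitz (restrict T V) z <= (coupling z)%:E)%E] `&` [set z | V z.1]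
    `<=` T.

Definition locates (V : set X) (T : operator) : Prop :=
  fst @` [set z | (fitz (restrict T V) z <= (coupling z)%:E)%E] `&` V
    `<=` domain T.

Definition V_NI (T : operator) (V : set X) : Prop :=
  forall z : Z, V z.1 -> ((coupling z)%:E <= fitz (restrict T V) z)%E.

Definition good_open (T : operator) (V : set X) : Prop :=
  open V /\ convex_set (V : set (convex_lmodType X)) /\ V `&` domain T !=set0.

Definition identifiable (T : operator) : Prop :=
  forall V, good_open T V -> identifies V T.
Definition locatable (T : operator) : Prop :=
  forall V, good_open T V -> locates V T.
Definition locally_NI (T : operator) : Prop :=
  forall V, good_open T V -> V_NI T V.

End Defs.

(* Main.v *)
(* A convex function fitz S that dominates the coupling c near z.1 and touches
   it at z satisfies the first-order condition fitz S w >= <z, w> - c(z) for all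
   w; by duality every lsc convex function that is at most c on S is then at
   most c(z) at z. Applied to S = T|V, this turns V-NI into psi_T(z) = c(z) for
   each z over V with fitz T|V z <= c(z); applied again over a small convex
   neighborhood of z.1 on which T is represented by some h, it gives
   h(z) <= c(z), i.e. z in T. That such small neighborhoods still meet the domain
   of T follows from local NI on thin tubes. In the other direction fitz T itself
   represents an identifiable T. *)
From Pilot Require Import Defs.
From HB Require Import structures.
From mathcomp Require Import all_boot all_order all_algebra.
From mathcomp Require Import all_classical all_reals all_analysis.
From mathcomp Require Import ring lra.
Set Implicit Arguments. Unset Strict Implicit. Unset Printing Implicit Defensive.
Import Order.TTheory GRing.Theory Num.Theory.
Import numFieldTopology.Exports numFieldNormedType.Exports.
Local Open Scope classical_set_scope.
Local Open Scope ring_scope.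
(* MathComp-Analysis shadows monotone and restrict. *)
Import Pilot.Defs.

Lemma lt_convex_comb (R : realDomainType) (t a b c : R) :
  0 <= t <= 1 -> a < c -> b < c -> t * a + (1 - t) * b < c.
Proof.
move=> /andP[t0 t1] ac bc; have [->|tn0] := eqVneq t 0; first by lra.
have tp : 0 < t by rewrite lt_neqAle eq_sym tn0.
have : t * a < t * c by rewrite ltr_pM2l.
have : (1 - t) * b <= (1 - t) * c by apply: ler_wpM2l; lra.
lra.
Qed.

(** * Extension of linear functionals nonnegative on a convex cone *)

Section RieszExtension.
Variables (R : realType) (E : lmodType R).

(** M. Riesz extension. Zorn gives a maximal graph of a partial functional; a missing [y] could
    still be given a value between the bounds forced by positivity, and both bounds exist because
    [k0] is an order unit for [K]. *)
Lemma riesz_extension (K : set E) (k0 : E) :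
  (forall x y, K x -> K y -> K (x + y)) ->
  (forall t x, 0 < t -> K x -> K (t *: x)) ->
  ~ K 0 ->
  (forall y, exists2 t : R, 0 < t & K (t *: k0 + y)) ->
  exists f : {scalar E}, f k0 = 1 /\ forall x, K x -> 0 <= f x.
Proof.
move=> KD KZ K0 Kint.
(* Graphs of partial functionals. Shifting by (k0, 1) is required instead of
   containing it, so that the empty chain has an upper bound. *)
pose P (G : set (E * R)) := [/\
  forall a u v, G u -> G v -> G (a *: u.1 + v.1, a * u.2 + v.2),
  forall u t, G u -> G (u.1 + t *: k0, u.2 + t) &
  forall u, G u -> K u.1 -> 0 <= u.2].
have [|A [[Alin Ak0 Apos] Amax]] := @Zorn_bigcup _ P.
  move=> F FP totF; split.
  - move=> a u v [G1 FG1 G1u] [G2 FG2 G2v].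
    have [G12|G21] := totF _ _ FG1 FG2.
      exists G2 => //; have [lin _ _] := FP _ FG2.
      by apply: lin => //; exact: G12.
    exists G1 => //; have [lin _ _] := FP _ FG1.
    by apply: lin => //; exact: G21.
  - by move=> u t [G FG Gu]; exists G => //; have [_ H _] := FP _ FG; exact: H.
  - by move=> u [G FG Gu]; have [_ _ H] := FP _ FG; exact: H.
have Kk0 : K k0.
  have [t t0] := Kint 0; rewrite addr0 => /(KZ t^-1).
  by rewrite invr_gt0 scalerA mulVf ?gt_eqF// scale1r => /(_ t0).
have A0 : A (0, 0).
  have [[u Au]|A_empty] := pselect (A !=set0).
    by have := Alin (-1) _ _ Au Au; rewrite scaleN1r mulN1r !addNr.
  (* The line through [(k0, 1)] properly extends an empty graph. It is admissible: [r *: k0] in [K]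
     with [r < 0] would put [0] in [K]. *)
  pose G0 := [set u : E * R | u.1 = u.2 *: k0].
  exfalso; apply: (Amax G0).
    split=> [u Au|]; first by case: A_empty; exists u.
    move=> /(_ (0, 0)) H; apply: A_empty; exists (0, 0).
    by apply: H; rewrite /G0 /= scale0r.
  split; rewrite /G0 /=.
  - by move=> a u v -> ->; rewrite scalerDl scalerA.
  - by move=> u t ->; rewrite scalerDl.
  - move=> [_ r] /= -> Kr; rewrite leNgt; apply/negP => r0; apply: K0.
    have := KD _ _ Kk0 (KZ (- r)^-1 _ _ Kr).
    rewrite scalerA invrN mulNr mulVf ?lt_eqF// scaleN1r subrr; apply.
    by rewrite -invrN invr_gt0 oppr_gt0.
have Atot y : exists s, A (y, s).
  (* [S] holds the lower bounds that positivity at [u.1 + y] imposes on the value at [y]. Positivity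
     at [u.1 - y] gives upper bounds, and adding the two points shows that they are compatible. *)
  pose S := [set - u.2 | u in [set u | A u /\ K (u.1 + y)]].
  have Kneg : exists2 u, A u & K (u.1 - y).
    by have [t _ Kt] := Kint (- y); exists (0 + t *: k0, 0 + t);
      [exact: (Ak0 (0, 0)) | rewrite /= add0r].
  have Kpos : exists2 u, A u & K (u.1 + y).
    by have [t _ Kt] := Kint y; exists (0 + t *: k0, 0 + t);
      [exact: (Ak0 (0, 0)) | rewrite /= add0r].
  have ubS u : A u -> K (u.1 - y) -> ubound S u.2.
    move=> Au Ku _ [v [Av Kv] <-].
    have := Apos _ (Alin 1 _ _ Au Av); rewrite /= scale1r mul1r => H.
    suff : 0 <= u.2 + v.2 by lra.
    by apply: H; have := KD _ _ Ku Kv; rewrite addrACA addNr addr0.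
  have S0 : S !=set0 by have [u Au Ku] := Kpos; exists (- u.2); exists u.
  have hsS : has_sup S.
    by split => //; have [u Au Ku] := Kneg; exists u.2; exact: ubS.
  pose s := sup S; exists s.
  pose B := [set v : E * R | exists u t, A u /\ v = (u.1 + t *: y, u.2 + t * s)].
  have Bys : B (y, s) by exists (0, 0), 1; rewrite /= scale1r mul1r !add0r.
  have AB : A `<=` B.
    by move=> [u r] Au; exists (u, r), 0; rewrite /= scale0r mul0r !addr0.
  suff PB : P B.
    apply: contrapT => nA; apply: (Amax B) => //; split=> // BA.
    by apply: nA; exact: BA.
  split.
  - move=> a _ _ [u1 [t1 [Au1 ->]]] [u2 [t2 [Au2 ->]]] /=.
    exists (a *: u1.1 + u2.1, a * u1.2 + u2.2), (a * t1 + t2).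
    split; first exact: Alin.
    congr (_, _); rewrite /=; last by ring.
    by rewrite !scalerDr scalerDl scalerA addrACA.
  - move=> _ t [u [t1 [Au ->]]] /=; exists (u.1 + t *: k0, u.2 + t), t1.
    split; first exact: Ak0.
    by congr (_, _); rewrite /= addrAC.
  - move=> _ [u [t [Au ->]]] /= Ku.
    have AZ a v : A v -> A (a *: v.1, a * v.2).
      by move=> Av; have := Alin a _ _ Av A0; rewrite /= !addr0.
    have [t0|t0|t0] := ltgtP t 0.
    + have t0' : 0 < (- t)^-1 by rewrite invr_gt0 oppr_gt0.
      have Au' := AZ (- t)^-1 _ Au.
      have /(ubS _ Au')/= H : K ((- t)^-1 *: u.1 - y).
        have := KZ _ _ t0' Ku; rewrite scalerDr scalerA invrN mulNr.
        by rewrite mulVf ?lt_eqF// scaleN1r.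
      have : s <= (- t)^-1 * u.2 by apply: ge_sup.
      rewrite mulrC ler_pdivlMr ?oppr_gt0//; lra.
    + have t0' : 0 < t^-1 by rewrite invr_gt0.
      have Au' := AZ t^-1 _ Au.
      have : - (t^-1 * u.2) <= s.
        apply: ub_le_sup; first by case: hsS.
        exists (t^-1 *: u.1, t^-1 * u.2) => //; split => //=.
        by have := KZ _ _ t0' Ku; rewrite scalerDr scalerA mulVf ?gt_eqF// scale1r.
      rewrite mulrC -mulNr ler_pdivrMr//; lra.
    + move: Ku; rewrite t0 scale0r mul0r !addr0; exact: Apos.
have /choice [f Af] := Atot.
(* Single-valuedness: a value [d != 0] over [0] rescales to [-2], and the shift by [(k0, 1)] then
   gives [k0] the value [-1], against positivity. *)
have A00 d : A (0, d) -> d = 0.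
  move=> Ad; apply: contrapT => /eqP d0.
  have := Ak0 _ 1 (Alin (- 2 / d) _ _ Ad A0).
  rewrite /= scaler0 scale1r !add0r addr0 divfK// => /Apos /(_ Kk0) /=; lra.
have Afun x r : A (x, r) -> r = f x.
  move=> Ar; have := Alin (-1) _ _ (Af x) Ar.
  by rewrite /= scaleN1r addNr => /A00; lra.
have flin : GRing.linear_for *%R f.
  by move=> a x y; apply/esym/Afun; exact: Alin (Af x) (Af y).
pose fL := GRing.isLinear.Build R E R *%R f flin.
pose g : {scalar E} := HB.pack_for {scalar E} f fL.
exists g; split=> [|x Kx]; last exact: (Apos _ (Af x)).
by apply/esym/Afun; have := Ak0 _ 1 A0; rewrite /= scale1r !add0r.
Qed.

End RieszExtension.

(** * Algebraic separation of convex sets *)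

Section ConvexSeparation.
Variables (R : realType) (E : lmodType R).

Lemma convex_setP (A : set E) :
  convex_set (A : set (convex_lmodType E)) <->
  forall x y t, 0 <= t <= 1 -> A x -> A y -> A (t *: x + (1 - t) *: y).
Proof.
split=> cA x y t.
  move=> t01 /mem_set Ax /mem_set Ay.
  have := cA x y (Itv01 (andP t01).1 (andP t01).2) Ax Ay.
  by rewrite inE.
rewrite !inE => Ax Ay; apply: cA => //.
by apply/andP; split.
Qed.

(** Every point of [B] is an algebraic interior point. The notion is purely linear, so separation
    applies in any [lmodType]. *)
Definition radially_open (B : set E) := forall b v, B b ->
  exists2 e : R, 0 < e & forall t, `|t| < e -> B (b + t *: v).

Lemma radially_open_near (B : set E) : radially_open B <->
  forall b v, B b -> \forall t \near (0 : R), B (b + t *: v).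
Proof.
split=> oB b v /(oB _ v).
  move=> [e e0 He]; apply/nbhs_ballP; exists e => // t.
  by rewrite /ball /= sub0r normrN => /He.
move=> /nbhs_ballP[e e0 He]; exists e => // t te.
by apply: He; rewrite /ball /= sub0r normrN.
Qed.

(** Riesz extension for the cone generated by [A - B]. Openness of [B] makes [a0 - b0] an order
    unit; moving [b] slightly along [a0 - b0], where [f] is [1], makes the inequality strict. *)
Lemma convex_separation (A B : set E) :
  convex_set (A : set (convex_lmodType E)) ->
  convex_set (B : set (convex_lmodType E)) ->
  radially_open B -> A !=set0 -> B !=set0 -> A `&` B = set0 ->
  exists f : {scalar E}, forall a b, A a -> B b -> f b < f a.
Proof.
move=> /convex_setP cA /convex_setP cB oB [a0 Aa0] [b0 Bb0] AB0.
pose K := [set x | exists t a b, [/\ 0 < t, A a, B b & x = t *: (a - b)]].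
have [||||f [f1 fK]] := @riesz_extension R E K (a0 - b0).
- move=> _ _ [t1 [a1 [b1 [t10 Aa1 Bb1 ->]]]] [t2 [a2 [b2 [t20 Aa2 Bb2 ->]]]].
  have t12 : t1 + t2 != 0 by rewrite gt_eqF// addr_gt0.
  pose t := t1 / (t1 + t2).
  have t01 : 0 <= t <= 1.
    have t12' : 0 < t1 + t2 by lra.
    by rewrite /t ler_pdivlMr// ler_pdivrMr// mul0r; apply/andP; lra.
  exists (t1 + t2), (t *: a1 + (1 - t) *: a2), (t *: b1 + (1 - t) *: b2).
  split; [by rewrite addr_gt0 | exact: cA | exact: cB |].
  rewrite opprD addrACA -!scalerBr [in RHS]scalerDr !scalerA; congr (_ *: _ + _ *: _).
    by rewrite /t; field.
  by rewrite /t; field.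
- move=> t _ t0 [t1 [a1 [b1 [t10 Aa1 Bb1 ->]]]].
  by exists (t * t1), a1, b1; split => //; rewrite ?mulr_gt0// scalerA.
- move=> [t [a [b [t0 Aa Bb /esym/eqP]]]].
  rewrite scaler_eq0 gt_eqF//= subr_eq0 => /eqP ab.
  have : (A `&` B) a by split => //; rewrite ab.
  by rewrite AB0.
- move=> y; have [e e0 Be] := oB b0 (- y) Bb0.
  have e2 : 0 < 2 / e by rewrite divr_gt0.
  exists (2 / e) => //; exists (2 / e), a0, (b0 + (e / 2) *: (- y)); split => //.
    by apply: Be; rewrite gtr0_norm ?divr_gt0//; lra.
  rewrite opprD scalerN opprK addrA [in RHS]scalerDr scalerA.
  have -> : 2 / e * (e / 2) = 1 by field; rewrite gt_eqF.
  by rewrite scale1r.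
exists f => a b Aa Bb.
have ge0 a' b' : A a' -> B b' -> f b' <= f a'.
  move=> Aa' Bb'; rewrite -subr_ge0 -linearB; apply: fK.
  by exists 1, a', b'; rewrite scale1r.
have [e e0 Be] := oB b (a0 - b0) Bb.
have := ge0 a (b + (e / 2) *: (a0 - b0)) Aa.
have Be2 : B (b + (e / 2) *: (a0 - b0)).
  by apply: Be; rewrite gtr0_norm ?divr_gt0//; lra.
move=> /(_ Be2); rewrite linearD linearZ /= f1 mulr1; lra.
Qed.

End ConvexSeparation.

(** * Convex neighborhoods and continuity of linear functionals *)

Section LocallyConvex.
Variables (R : realType) (X : tvsType R).

Lemma nbhs_open_convex (x : X) (U : set X) : nbhs x U -> exists V : set X,
  [/\ open V, convex_set (V : set (convex_lmodType X)), V x & V `<=` U].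
Proof.
have [B cB [oB bB]] := @locally_convex R X.
move=> /bB [V [BV Vx] VU]; exists V; split => //; first exact: oB.
by apply: cB; rewrite inE.
Qed.

Lemma tvs_continuousD (T : topologicalType) (f g : T -> X) (x : T) :
  {for x, continuous f} -> {for x, continuous g} ->
  {for x, continuous (fun t => f t + g t)}.
Proof.
move=> cf cg.
apply: (@continuous_comp _ _ _ (fun t => (f t, g t))
  (fun z : X * X => z.1 + z.2)).
  exact: (@cvg_pair _ _ _ _ (nbhs (f x)) (nbhs (g x))).
exact: add_continuous.
Qed.

Lemma tvs_continuousZ (T : topologicalType) (k : T -> R^o) (g : T -> X) (x : T) :
  {for x, continuous k} -> {for x, continuous g} ->
  {for x, continuous (fun t => k t *: g t)}.
Proof.
move=> ck cg.
apply: (@continuous_comp _ _ _ (fun t => (k t, g t))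
  (fun z : R^o * X => z.1 *: z.2)).
  exact: (@cvg_pair _ _ _ _ (nbhs (k x)) (nbhs (g x))).
exact: scale_continuous.
Qed.

Lemma open_radially_open (V : set X) : open V -> radially_open V.
Proof.
move=> oV b v Vb.
have ct : {for (0 : R^o), continuous (fun t : R^o => b + t *: v)}.
  apply: tvs_continuousD; first exact: cvg_cst.
  by apply: tvs_continuousZ; [exact: cvg_id | exact: cvg_cst].
have : nbhs (b + 0 *: v) V by rewrite scale0r addr0; exact: open_nbhs_nbhs.
move=> /ct /nbhs_ballP [e e0 He]; exists e => // t te.
by apply: He; rewrite /ball /= sub0r normrN.
Qed.

(** Translation to [0] and symmetry turn the one-sided bound into a bound on the absolute value near
    [0], which homogeneity then makes arbitrarily small. *)
Lemma linear_bounded_above_continuous (f : {scalar X}) (x : X) (U : set X)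
    (M : R) :
  nbhs x U -> (forall y, U y -> f y <= M) -> continuous f.
Proof.
move=> Ux fM.
have U0 : nbhs (0 : X) [set v | f v <= M - f x].
  have : nbhs (x + 0) U by rewrite addr0.
  have ct : {for (0 : X), continuous (fun v : X => x + v)}.
    by apply: tvs_continuousD; [exact: cvg_cst | exact: cvg_id].
  move=> /ct H; have : \forall v \near (0 : X), U (x + v) by [].
  apply: filterS => v /fM; rewrite linearD /=; lra.
pose C := `|M - f x| + 1.
have C0 : 0 < C by rewrite ltr_wpDl.
have CM : M - f x <= C by rewrite /C (le_trans (ler_norm _))// lerDl.
have UC : nbhs (0 : X) [set v | `|f v| <= C].
  have := nbhs0N U0; move: U0; apply: filterS2 => v /= fv [w /= fw wv].
  rewrite ler_norml -wv linearN /= lerN2.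
  by move: fv; rewrite -wv linearN /=; lra.
move=> y; apply/cvgrPdist_lt => e e0.
have ct : {for y, continuous (fun v : X => (2 * C / e) *: (v - y))}.
  apply: tvs_continuousZ; first exact: cvg_cst.
  by apply: tvs_continuousD; [exact: cvg_id | exact: cvg_cst].
have : nbhs ((2 * C / e) *: (y - y)) [set v | `|f v| <= C].
  by rewrite subrr scaler0.
move=> /ct H.
have : \forall v \near y, `|f ((2 * C / e) *: (v - y))| <= C by [].
apply: filterS => v /=.
rewrite linearZ /= normrM linearB /= gtr0_norm ?divr_gt0 ?mulr_gt0// distrC.
rewrite mulrAC ler_pdivrMr// => fC.
have : 2 * `|f y - f v| <= e by rewrite -(ler_pM2l C0) mulrCA mulrA.
lra.
Qed.

End LocallyConvex.

(** * Dual elements and the Fitzpatrick function *)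

Section Dual.
Variables (R : realType) (X : tvsType R).
Implicit Types (p q : dual X) (S T : operator X) (z w : Z X).

HB.instance Definition _ p :=
  @GRing.isLinear.Build R X R *%R (dfun p) (dfun_linear p).

Lemma dual_comb (a b : R) p q :
  exists r : dual X, forall u, r u = a * p u + b * q u.
Proof.
have lin c (x y : X) : a * p (c *: x + y) + b * q (c *: x + y) =
    c * (a * p x + b * q x) + (a * p y + b * q y).
  by rewrite !linearP /=; ring.
have cont : continuous (fun u : X => a * p u + b * q u).
  move=> u; apply: cvgD; apply: cvgM;
    by [exact: cvg_cst | exact: dfun_cont].
by exists (Dual lin cont).
Qed.

Lemma dual_of_scalar (f : {scalar X}) :
  continuous f -> exists p, forall u, p u = f u.
Proof.
move=> cf.
have lin c (x y : X) : f (c *: x + y) = c * f x + f y by rewrite linearP.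
by exists (Dual lin cf).
Qed.

Lemma fitz_leP S w (r : R) : (fitz S w <= r%:E)%E <->
  forall u, S u -> u.2 w.1 + w.2 u.1 - u.2 u.1 <= r.
Proof.
split=> [H u Su|H].
  rewrite -lee_fin; apply: le_trans H; apply: ereal_sup_ubound.
  by exists u.
by apply: ge_ereal_sup => _ [u Su <-]; rewrite lee_fin; exact: H.
Qed.

Lemma fitz_ge S w u : S u -> ((u.2 w.1 + w.2 u.1 - u.2 u.1)%:E <= fitz S w)%E.
Proof. by move=> Su; apply: ereal_sup_ubound; exists u. Qed.

Lemma fitz_subset S T w : S `<=` T -> (fitz S w <= fitz T w)%E.
Proof. by move=> ST; apply: le_ereal_sup; exact: image_subset. Qed.

Lemma fitz_convex S : Zconvex (fitz S).
Proof.
move=> z1 z2 z t r1 r2 /andP[t0 t1] [zE1 zE2] /fitz_leP H1 /fitz_leP H2.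
apply/fitz_leP => u Su; rewrite zE1 zE2 linearD !linearZ /=.
have := ler_wpM2l t0 (H1 _ Su); have := ler_wpM2l (_ : 0 <= 1 - t) (H2 _ Su).
rewrite subr_ge0 => /(_ t1); lra.
Qed.

(** A value above [r] is witnessed by a single [u] in [S], whose affine function is continuous for
    the product topology: the only test point needed is [u.1]. *)
Lemma fitz_lsc S : Zlsc (fitz S).
Proof.
move=> r z /= /fitz_leP/existsNP[u /not_implyP[Su /negP]].
rewrite -ltNge => ur.
set d := u.2 z.1 + z.2 u.1 - u.2 u.1 - r.
have d0 : 0 < d / 2 by rewrite divr_gt0// subr_gt0.
exists [set y | `|u.2 z.1 - u.2 y| < d / 2]; split.
  by have /cvgrPdist_lt := @dfun_cont _ _ u.2 z.1; apply.
exists [:: u.1], (d / 2); split => // y /= Uy /(_ u.1).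
rewrite inE eqxx => /(_ isT) zy /fitz_leP /(_ _ Su) H.
move: Uy zy; rewrite !ltr_norml => /andP[h1 h2] /andP[h3 h4].
have dE : d = u.2 z.1 + z.2 u.1 - u.2 u.1 - r by [].
lra.
Qed.

Lemma fitz_monotone T z : monotone T -> T z -> (fitz T z <= (coupling z)%:E)%E.
Proof.
move=> mT Tz; apply/fitz_leP => u Tu.
have := mT _ _ Tz Tu; rewrite /coupling; lra.
Qed.

Lemma monotone_restrict T (V : set X) :
  monotone T -> monotone (restrict T V).
Proof. by move=> mT z w [Tz _] [Tw _]; exact: mT. Qed.

End Dual.

(** * Duality between lsc convex minorants and the Fitzpatrick function *)

Section Conjugate.
Variables (R : realType) (X : tvsType R).
Implicit Types (S T : operator X) (z w : Z X).

(* The weak-star topology enters only through the finitely many points of s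
   that witness lower semicontinuity at z, so the separation takes place in
   X * 'rV_(size s) * R. A vertical hyperplane (m = 0) is made non-vertical by
   adding a large multiple of it to w0. *)
Lemma lsc_convex_separation S (g : Z X -> \bar R) z (r : R) :
  Zconvex g -> Zlsc g -> (forall u, S u -> (g u <= (coupling u)%:E)%E) ->
  (r%:E < g z)%E -> S !=set0 ->
  (exists w0 (a0 : R), forall u, S u -> u.2 w0.1 + w0.2 u.1 - u.2 u.1 <= a0) ->
  exists w (a : R), (forall u, S u -> u.2 w.1 + w.2 u.1 - u.2 u.1 <= a) /\
    a < z.2 w.1 + w.2 z.1 - r.
Proof.
move=> cvxg lscg gS rg [u0 Su0] [w0 [a0 Hw0]].
(* The gap between [r] and [r'] puts [bz], at height [r], inside the radially open box [B]. *)
have [r' [rr' r'g]] : exists r', r < r' /\ (r'%:E < g z)%E.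
  case: (g z) rg => [x| |] //=; rewrite ?lte_fin => rx.
    by exists ((r + x) / 2); rewrite lte_fin; split; lra.
  by exists (r + 1); rewrite ltry; split => //; lra.
have /(lscg r')[U [Uz [s [e [e0 Hg]]]]] : (~` [set y | (g y <= r'%:E)%E]) z.
  by move=> /=; rewrite leNgt r'g.
have [V [oV cV Vz VU]] := nbhs_open_convex Uz.
pose n := size s.
pose ev (p : dual X) : 'rV[R]_n := \row_i p (nth 0 s i).
pose E := (X * 'rV[R]_n * R^o)%type.
pose B : set E := [set q : E | [/\ V q.1.1,
  forall i : 'I_n, `|q.1.2 0 i - z.2 (nth 0 s i)| < e & q.2 < r']].
(* The image of the epigraph of [g]. It misses [B] because [g] exceeds [r'] on the neighborhood of
   [z] given by lower semicontinuity. *)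
pose A : set E := [set q : E | exists p, q.1.2 = ev p /\
  (g (q.1.1, p) <= (q.2 : R)%:E)%E].
pose bz : E := ((z.1, ev z.2), r).
have Bbz : B bz by split => // i; rewrite /= mxE subrr normr0.
have AS u (k : R) : S u -> 0 <= k -> A ((u.1, ev u.2), coupling u + k).
  move=> Su k0; exists u.2; split => //=; rewrite -surjective_pairing.
  by apply: le_trans (gS _ Su) _; rewrite lee_fin lerDl.
have Aa0 := AS u0 0 Su0 (lexx _).
set qa : E := (_, _) in Aa0.
have oB : radially_open B.
  apply/radially_open_near => -[[x1 v1] k1] [[x2 v2] k2] [/= V1 H1 R1].
  have N1 : \forall t \near (0 : R), V (x1 + t *: x2).
    by move/open_radially_open/radially_open_near: oV; apply.
  pose dist (i : 'I_n) (t : R) := `|v1 0 i + t * v2 0 i - z.2 (nth 0 s i)|.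
  have N2 : \forall t \near (0 : R), forall i, dist i t < e.
    suff H i : \forall t \near (0 : R), dist i t < e.
      exact: (@filter_forall R 'I_n (fun i t => dist i t < e) _ _ H).
    have : dist i t @[t --> (0 : R)] --> dist i 0.
      apply: cvg_norm; apply: cvgB; last exact: cvg_cst.
      apply: cvgD; first exact: cvg_cst.
      by apply: cvgM; [exact: cvg_id | exact: cvg_cst].
    by move=> /cvgr_lt; apply; rewrite /dist mul0r addr0.
  have N3 : \forall t \near (0 : R), k1 + t * k2 < r'.
    have : k1 + t * k2 @[t --> (0 : R)] --> k1 + 0 * k2.
      apply: cvgD; first exact: cvg_cst.
      by apply: cvgM; [exact: cvg_id | exact: cvg_cst].
    by move=> /cvgr_lt; apply; rewrite mul0r addr0.
  near=> t; split => /=.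
  + by near: t.
  + move=> i; rewrite !mxE; move: i; near: t; exact: N2.
  + by near: t; exact: N3.
have [||||||f fAB] := @convex_separation R E A B.
- apply/convex_setP => -[[x1 v1] k1] [[x2 v2] k2] t t01 /=.
  move=> [p1 [/= -> g1]] [p2 [/= -> g2]].
  have [p pE] := dual_comb t (1 - t) p1 p2.
  exists p; split => /=.
    by apply/rowP => i; rewrite !mxE pE.
  exact: (cvxg (x1, p1) (x2, p2) _ t).
- apply/convex_setP => -[[x1 v1] k1] [[x2 v2] k2] t t01 /=.
  move=> [/= V1 H1 R1] [/= V2 H2 R2].
  have [t0 t1] := andP t01.
  split => /=.
  + by move/convex_setP: cV; apply.
  + move=> i; rewrite !mxE; move: (H1 i) (H2 i); rewrite !ltr_norml.
    move=> /andP[h1 h2] /andP[h3 h4].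
    rewrite -ltrN2 opprK in h1; rewrite -ltrN2 opprK in h3.
    have := lt_convex_comb t01 h1 h3; have := lt_convex_comb t01 h2 h4.
    by move=> h5 h6; apply/andP; split; lra.
  + exact: lt_convex_comb.
- exact: oB.
- by exists qa.
- by exists bz.
- rewrite -subset0 => -[[x1 v1] k1] [[p [/= -> gp]] [/= V1 H1 R1]].
  apply: (Hg (x1, p)) => /=; first exact: VU.
    move=> u us; have un : (index u s < n)%N by rewrite index_mem.
    by have := H1 (Ordinal un); rewrite mxE /= nth_index.
  by apply: le_trans gp _; rewrite lee_fin ltW.
pose f1 x : R := f ((x, 0), 0).
have f1lin : GRing.linear_for *%R f1.
  move=> c x y; rewrite /f1 -linearP; congr (f _).
  by congr ((_, _), _); rewrite /= ?scaler0 addr0.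
pose f1s : {scalar X} := HB.pack_for {scalar X} f1
  (GRing.isLinear.Build R X R *%R f1 f1lin).
pose f2 v : R := f ((0, v), 0).
have f2lin : GRing.linear_for *%R f2.
  move=> c x y; rewrite /f2 -linearP; congr (f _).
  by congr ((_, _), _); rewrite /= ?scaler0 addr0.
pose f2s : {scalar 'rV[R]_n} := HB.pack_for {scalar 'rV[R]_n} f2
  (GRing.isLinear.Build R 'rV[R]_n R *%R f2 f2lin).
pose m : R := f ((0, 0), 1).
(* The part of [f] acting on [ev p] is evaluation of [p] at this point of [X]. *)
pose a := \sum_i f2 (delta_mx 0 i) *: nth 0 s i.
have fE x p (k : R) : f ((x, ev p), k) = f1 x + p a + k * m.
  have -> : ((x, ev p), k) =
      ((x, 0), 0) + ((0, ev p), 0) + k *: ((0, 0), 1) :> E.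
    congr ((_, _), _); rewrite /= ?scaler0 ?add0r ?addr0//.
    by rewrite /GRing.scale /= mulr1.
  rewrite !linearD linearZ /=; congr (_ + _ + _).
  rewrite -/(f2 (ev p)) -[f2]/(f2s : _ -> _) [ev p]row_sum_delta !linear_sum.
  by apply: eq_bigr => i _; rewrite !linearZ /= mxE mulrC.
(* Over [V], the points of [B] with second coordinate [ev z.2] and height [r] stay below [f qa],
   which bounds [f1] from above. *)
have f1c : continuous f1s.
  apply: (@linear_bounded_above_continuous _ _ _ z.1 V (f qa - z.2 a - r * m)).
    exact: open_nbhs_nbhs.
  move=> y Vy; rewrite -[f1s y]/(f1 y).
  have : f ((y, ev z.2), r) < f qa.
    by apply: fAB => //; case: Bbz => _ ? ?; split.
  rewrite fE; lra.
have [d dE] := dual_of_scalar f1c.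
(* Moving [bz] towards [qa] inside [B] raises [f], giving a level [al] strictly above [f bz] and
   still below [f] on [A]. *)
have [e1 e10 Be1] := oB _ (qa - bz) Bbz.
have := Be1 (e1 / 2); rewrite gtr0_norm ?divr_gt0// => /(_ ltac:(lra)) Bb1.
pose al := f (bz + (e1 / 2) *: (qa - bz)).
have alz : d z.1 + z.2 a + r * m < al.
  rewrite dE -[f1s _]/(f1 _) -fE -/bz /al linearD linearZ /= linearB /= ltrDl.
  by rewrite mulr_gt0 ?divr_gt0// subr_gt0; exact: fAB.
have alS u (k : R) : S u -> 0 <= k -> al < d u.1 + u.2 a + (coupling u + k) * m.
  by move=> Su k0; rewrite dE -[f1s _]/(f1 _) -fE; apply: fAB => //; exact: AS.
(* Heights in [A] can grow without bound, so a negative slope would drive [f] below [al]. *)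
have m0 : 0 <= m.
  rewrite leNgt; apply/negP => m0.
  pose c0 := d u0.1 + u0.2 a + coupling u0 * m - al.
  have := alS u0 (`|c0| / - m) Su0 (divr_ge0 (normr_ge0 _) _).
  rewrite oppr_ge0 ltW// => /(_ isT).
  rewrite mulrDl invrN mulrN mulNr divfK ?lt_eqF//.
  have := ler_norm c0; rewrite /c0; lra.
have [meq0|mneq0] := eqVneq m 0.
  pose dl := al - (d z.1 + z.2 a).
  have dl0 : 0 < dl by rewrite /dl; move: alz; rewrite meq0; lra.
  pose C := z.2 w0.1 + w0.2 z.1 - r.
  (* Subtracting [t] times the vertical hyperplane lowers [a0 - C] by [t * dl], which must exceed
     it. *)
  pose t := (`|a0 - C| + 1) / dl.
  have t0 : 0 <= t by rewrite divr_ge0// ltW// addr_gt0.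
  have tdl : t * dl = `|a0 - C| + 1 by rewrite /t divfK// gt_eqF.
  have [p pE] := dual_comb 1 (- t) w0.2 d.
  exists (w0.1 + (- t) *: a, p), (a0 - t * al); split => [u Su|] /=.
    rewrite pE linearD linearZ /=.
    have := Hw0 _ Su; have := ler_wpM2l t0 (ltW (alS u 0 Su (lexx _))).
    rewrite meq0; lra.
  rewrite pE (linearD z.2) (linearZ_LR z.2) /=.
  have := ler_norm (a0 - C); rewrite /C; move: tdl; rewrite /dl /C; lra.
have mp : 0 < m by rewrite lt_neqAle eq_sym mneq0.
(* Dividing by [- m] normalizes the coefficient of the height to [-1]. *)
have [p pE] := dual_comb (- m^-1) 0 d d.
exists ((- m^-1) *: a, p), (- m^-1 * al).
split => [u Su|] /=; rewrite pE linearZ /=.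
  have := ler_wpM2l (ltW (_ : 0 < m^-1)) (ltW (alS u 0 Su (lexx _))).
  rewrite invr_gt0 => /(_ mp).
  have -> : m^-1 * (d u.1 + u.2 a + (coupling u + 0) * m) =
      m^-1 * (d u.1 + u.2 a) + u.2 u.1.
    by rewrite /coupling; field.
  lra.
have := ltr_pM2l (_ : 0 < m^-1) (d z.1 + z.2 a + r * m) al.
rewrite invr_gt0 alz => /(_ mp).
have -> : m^-1 * (d z.1 + z.2 a + r * m) = m^-1 * (d z.1 + z.2 a) + r.
  by field.
lra.
Unshelve. all: by end_near. Qed.

End Conjugate.

(** * Local NI, identifiability and representability *)

Section LocalNI.
Variables (R : realType) (X : tvsType R).
Implicit Types (S T : operator X) (z w : Z X) (V : set X).

(* The first-order optimality condition at z for fitz S - coupling, whose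
   nonnegativity is only needed near z.1 because fitz S is convex. *)
Lemma fitz_subgradient S V z w (a : R) : open V -> V z.1 ->
  (forall y, V y.1 -> ((coupling y)%:E <= fitz S y)%E) ->
  (fitz S z <= (coupling z)%:E)%E -> (fitz S w <= a%:E)%E ->
  z.2 w.1 + w.2 z.1 - coupling z <= a.
Proof.
move=> oV Vz ge zle wle; rewrite leNgt; apply/negP => aw.
have [e e0 Ve] := open_radially_open oV (w.1 - z.1) Vz.
pose q := z.2 w.1 + w.2 z.1.
pose g := q - coupling z - a.
have g0 : 0 < g by rewrite subr_gt0.
pose M := `|coupling z - q + coupling w| + 1.
have M0 : 0 < M by rewrite ltr_wpDl.
(* At [z + t (w - z)] the coupling is quadratic in [t]. The three bounds keep this point in [V],
   make it a convex combination, and hold the second-order contribution, after division by [t], to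
   at most [g / 2], against a first-order gain of [g]. *)
pose t := Num.min (Num.min (e / 2) 1) (g / (2 * M)).
have t0 : 0 < t by rewrite !lt_min ltr01 !divr_gt0// mulr_gt0.
have te : t <= e / 2 by rewrite !ge_min lexx.
have t1 : t <= 1 by rewrite !ge_min lexx orbT.
have tM : t * (2 * M) <= g.
  by rewrite -ler_pdivlMr ?mulr_gt0// /t ge_min lexx orbT.
have [p pE] := dual_comb t (1 - t) w.2 z.2.
pose y : Z X := (t *: w.1 + (1 - t) *: z.1, p).
have Vy : V y.1.
  have : V (z.1 + t *: (w.1 - z.1)) by apply: Ve; rewrite gtr0_norm//; lra.
  by rewrite scalerBr addrCA /y /= scalerBl scale1r.
have yle : (fitz S y <= (t * a + (1 - t) * coupling z)%:E)%E.
  by apply: (fitz_convex (z1 := w) (z2 := z)) => //; rewrite ltW.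
have := le_trans (ge _ Vy) yle; rewrite lee_fin {1}/coupling /y /= pE.
rewrite !linearD !linearZ /= => H.
have {H} : t * (q - coupling z - a) <= t * (t * - (coupling z - q + coupling w)).
  by move: H; rewrite /q /coupling; lra.
rewrite ler_pM2l// -/g => H.
have : t * - (coupling z - q + coupling w) <= t * M.
  rewrite ler_pM2l// /M.
  have := ler_norm (- (coupling z - q + coupling w)); rewrite normrN; lra.
move: tM g0 H; lra.
Qed.

(** If [g z] exceeded [coupling z], separation at height [coupling z] would give a [w] violating
    [fitz_subgradient]. *)
Lemma V_NI_minorant T V z (g : Z X -> \bar R) :
  monotone T -> good_open T V -> V_NI T V -> V z.1 ->
  (fitz (restrict T V) z <= (coupling z)%:E)%E ->
  Zconvex g -> Zlsc g ->
  (forall u, restrict T V u -> (g u <= (coupling u)%:E)%E) ->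
  (g z <= (coupling z)%:E)%E.
Proof.
move=> mT [oV [_ [x [Vx [xs Txs]]]]] NI Vz zle cg lg gle.
rewrite leNgt; apply/negP => cgz.
have Sx : restrict T V (x, xs) by split.
have [|w [a [Hw az]]] :=
  lsc_convex_separation cg lg gle cgz (ex_intro _ _ Sx).
  exists (x, xs), (coupling (x, xs)); apply/fitz_leP.
  exact: fitz_monotone (monotone_restrict mT) Sx.
have := fitz_subgradient oV Vz NI zle (proj2 (fitz_leP _ _ _) Hw).
by rewrite leNgt az.
Qed.

Lemma convex_setI (V W : set X) :
  convex_set (V : set (convex_lmodType X)) ->
  convex_set (W : set (convex_lmodType X)) ->
  convex_set (V `&` W : set (convex_lmodType X)).
Proof.
move=> /convex_setP cV /convex_setP cW.
apply/convex_setP => x y t t01 [Vx Wx] [Vy Wy].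
by split; [exact: cV | exact: cW].
Qed.

(* Otherwise T has no point above a neighborhood of z.1, and in a thin tube
   around the half-line from z.1 through a point of the domain, a functional f
   separates z.1 strictly from the domain of T; tilting z by -f then
   contradicts the NI property on the tube. *)
Lemma locally_NI_adherent T V z (W : set X) :
  locally_NI T -> good_open T V -> V z.1 ->
  (fitz (restrict T V) z <= (coupling z)%:E)%E ->
  nbhs z.1 W -> W `&` domain T !=set0.
Proof.
move=> NI [oV [cV [y [Vy Dy]]]] Vz /fitz_leP zle Wz; apply: contrapT => WD.
set x := z.1 in Vz Wz *.
have WnD u : W u -> ~ domain T u by move=> Wu Du; apply: WD; exists u.
have W0 : nbhs (0 : X) [set v | W (x + v)].
  have : nbhs (x + 0) W by rewrite addr0.
  have ct : {for (0 : X), continuous (fun v : X => x + v)}.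
    by apply: tvs_continuousD; [exact: cvg_cst | exact: cvg_id].
  by move=> /ct.
have [N [oN cN N0 NW]] := nbhs_open_convex W0.
have [||||f fN] :=
  @convex_separation R X [set y - x] N _ cN (open_radially_open oN).
- apply/convex_setP => _ _ t _ -> ->.
  by rewrite -scalerDl addrCA subrr addr0 scale1r.
- by exists (y - x).
- by exists 0.
- by rewrite -subset0 => _ [-> /NW]; rewrite /= addrC subrK => /WnD.
have fc : continuous f.
  apply: (@linear_bounded_above_continuous _ _ f 0 N (f (y - x))).
    exact: open_nbhs_nbhs.
  by move=> v Nv; apply/ltW/fN.
pose dl := f (y - x).
have dl0 : 0 < dl by rewrite -(linear0 f); exact: fN.
(* The factor [2], here and in [N (2 *: b)], allows a sum of two small vectors to be written as a
   midpoint of points of [N]. *)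
have [t0 t00 Nt0] := open_radially_open oN (2 *: (y - x)) N0.
pose eps := t0 * dl / 2.
have eps0 : 0 < eps by rewrite divr_gt0// mulr_gt0.
have D0 : nbhs (0 : X) [set b | N (2 *: b) /\ - eps < f b].
  apply: filterI.
    have ct : {for (0 : X), continuous (fun v : X => (2 : R) *: v)}.
      by apply: tvs_continuousZ; [exact: cvg_cst | exact: cvg_id].
    have : nbhs ((2 : R) *: (0 : X)) N by rewrite scaler0; exact: open_nbhs_nbhs.
    by move=> /ct.
  by have /cvgr_gt := fc 0; apply; rewrite linear0 oppr_lt0.
have [D [oD cD D00 DN]] := nbhs_open_convex D0.
pose tube := \bigcup_(t in [set t : R | 0 <= t])
  [set v | D (v + - (x + t *: (y - x)))].
have otube : open tube.
  apply: bigcup_open => t _.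
  apply: (@open_comp _ _ (fun v : X => v + - (x + t *: (y - x)))) => //.
  move=> v _; apply: (@tvs_continuousD _ _ X (fun v => v) (fun=> - _)).
    exact: cvg_id.
  exact: cvg_cst.
have ctube : convex_set (tube : set (convex_lmodType X)).
  apply/convex_setP => v1 v2 t t01 [/= t1 t10 D1] [/= t2 t20 D2].
  have [t0' t1'] := andP t01.
  exists (t * t1 + (1 - t) * t2) => /=; first by nra.
  have -> : x + (t * t1 + (1 - t) * t2) *: (y - x) =
      t *: (x + t1 *: (y - x)) + (1 - t) *: (x + t2 *: (y - x)).
    rewrite !(scalerDr _ x) addrACA -scalerDl !scalerA -scalerDl.
    have -> : t + (1 - t) = 1 by ring.
    by rewrite scale1r.
  have := (convex_setP _).1 cD _ _ _ t01 D1 D2; congr D.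
  by rewrite [in RHS]opprD [in RHS]addrACA -!scalerBr.
have gtube : good_open T (V `&` tube).
  split; first exact: openI.
  split; first exact: convex_setI.
  exists y; split => //; split => //; exists 1; first by rewrite /= ler01.
  by rewrite /= scale1r addrCA subrr addr0 subrr.
have [d dE] := dual_of_scalar fc.
have [p pE] := dual_comb 1 (-1) z.2 d.
have xtube : (V `&` tube) x.
  by split => //; exists 0; rewrite /= ?lexx// scale0r addr0 subrr.
have := NI _ gtube (x, p) xtube; apply/negP; rewrite -ltNge.
apply: (@le_lt_trans _ _ (coupling (x, p) - eps)%:E); last first.
  by rewrite lte_fin; lra.
apply/fitz_leP => u [Tu [Vu [t /= t_ge0 Du]]].
rewrite /coupling /= !pE !dE.
have := zle u (conj Tu Vu); rewrite -/x => zu.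
have [Nb fb] := DN _ Du.
(* For [t < t0], [u.1 - x] is the midpoint of [2 t (y - x)] and [2 b], both in [N], where [b] is the
   offset of [u.1] from the half-line; this would put a domain point in [W]. *)
have tt0 : t0 <= t.
  rewrite leNgt; apply/negP => tt0.
  apply: (WnD u.1); last by exists u.2; rewrite -surjective_pairing.
  have := Nt0 t; rewrite ger0_norm// => /(_ tt0); rewrite add0r => Nt.
  have h01 : 0 <= (2^-1 : R) <= 1 by apply/andP; lra.
  have := (convex_setP _).1 cN _ _ _ h01 Nt Nb.
  have -> : 1 - 2^-1 = 2^-1 :> R by lra.
  rewrite !scalerA.
  have -> : 2^-1 * t * 2 = t by lra.
  have -> : 2^-1 * 2 = 1 :> R by lra.
  rewrite scale1r.
  move=> /NW /=; congr W.
  by rewrite addrA addrC subrK.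
(* Since [t0 * dl] is [2 * eps] and the offset costs less than [eps], [f (u.1 - x)] is at least
   [eps], the drop gained by the tilt. *)
have : t0 * dl <= t * dl by rewrite ler_pM2r.
move: fb; rewrite linearB linearD (linearZ_LR f) /= -/dl.
move: zu; rewrite /coupling -/x /eps; lra.
Qed.

Lemma low_representable_locally_NI_identifiable T :
  monotone T -> low_representable T -> locally_NI T -> identifiable T.
Proof.
move=> mT lowT NI V gV z [/= zle Vz].
have [oV [cV V0]] := gV.
have T0 : good_open T setT.
  split; first exact: openT.
  split; first by apply/convex_setP.
  by case: V0 => x [_ Dx]; exists x.
have psiz : psi T z = (coupling z)%:E.
  apply/le_anti/andP; split.
    apply: ge_ereal_sup => _ [g [cg [lg gle]] <-].
    apply: (V_NI_minorant mT gV (NI _ gV)) => // u [Tu _].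
    by have := gle u; rewrite /c_plus_ind; case: asboolP.
  (* For the lower bound, [fitz T] is itself one of the lsc convex minorants defining [psi T], and
     it dominates the coupling by NI on the whole space. *)
  have := NI _ T0 z Logic.I.
  have -> : restrict T setT = T by apply/seteqP; split => // u [].
  move=> /le_trans; apply; apply: ereal_sup_ubound; exists (fitz T) => //.
  split; first exact: fitz_convex.
  split; first exact: fitz_lsc.
  move=> w; rewrite /c_plus_ind; case: asboolP => [Tw|_]; last exact: leey.
  exact: fitz_monotone.
have [U [Uz [_ [h [[_ [ch [lh hc]]] hE]]]]] := lowT z psiz.
have UV : nbhs z.1 (U `&` V) by apply: filterI => //; exact: open_nbhs_nbhs.
have [W [oW cW Wz WUV]] := nbhs_open_convex UV.
have gW : good_open T W.
  do 2 split => //; apply: (locally_NI_adherent NI gV Vz zle).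
  exact: open_nbhs_nbhs.
have zleW : (fitz (restrict T W) z <= (coupling z)%:E)%E.
  by apply: le_trans zle; apply: fitz_subset => u [Tu /WUV[]].
have hz : h z = (coupling z)%:E.
  apply/le_anti/andP; split; last exact: hc.
  apply: (V_NI_minorant mT gW (NI _ gW)) => // u [Tu /WUV[Uu _]].
  have : restrict T U u by split.
  by rewrite -hE => -[/= -> _].
have : restrict T U z by rewrite -hE; split => //=; case: (WUV _ Wz).
by case.
Qed.

(** A [z] with [fitz] below the coupling would lie over the domain, and the term of any point of [T]
    above [z.1] equals [coupling z]. *)
Lemma locatable_locally_NI T : locatable T -> locally_NI T.
Proof.
move=> locT V gV z Vz.
have [zlt|//] := ltP (fitz (restrict T V) z) (coupling z)%:E.
have [xs Txs] : domain T z.1.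
  by apply: (locT V gV); split => //; exists z => //=; exact: ltW.
have : restrict T V (z.1, xs) by split.
move=> /(@fitz_ge _ _ _ z) /=.
by rewrite addrAC subrr add0r -[z.2 z.1]/(coupling z) leNgt zlt.
Qed.

Lemma representable_low_representable T :
  representable T -> low_representable T.
Proof. by move=> rT z _; exists setT; split => //; exact: filterT. Qed.

(** At the midpoint of two points of [T], [h] lies above the coupling and below the mean of the two
    couplings; four times this gap is the monotonicity expression. *)
Lemma representable_in_M T : representable T -> in_M T.
Proof.
move=> [[x [_ [xs Tx]]] [h [[_ [ch [_ hc]]] hE]]]; split; last by exists (x, xs).
have hT z : T z -> h z = (coupling z)%:E.
  move=> Tz; have : restrict T setT z by split.
  by rewrite -hE => -[].
move=> z w Tz Tw.
have [p pE] := dual_comb 2^-1 (1 - 2^-1) z.2 w.2.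
pose y : Z X := (2^-1 *: z.1 + (1 - 2^-1) *: w.1, p).
have h01 : 0 <= (2^-1 : R) <= 1 by apply/andP; lra.
have := ch z w y _ _ _ h01 (conj erefl pE).
rewrite (hT _ Tz) (hT _ Tw) => /(_ _ _ (lexx _) (lexx _)) hy.
have := le_trans (hc y) hy; rewrite lee_fin {1}/coupling /y /= pE.
rewrite !linearD !linearZ /= /coupling; lra.
Qed.

Lemma identifiable_locatable T : identifiable T -> locatable T.
Proof.
move=> idT V gV x [[z /= zle <-] Vz]; exists z.2; rewrite -surjective_pairing.
exact: (idT V gV).
Qed.

Lemma identifiable_representable T :
  in_M T -> identifiable T -> representable T.
Proof.
move=> [mT [z0 Tz0]] idT.
have rT : restrict T setT = T by apply/seteqP; split => // u [].
have gT : good_open T setT.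
  split; first exact: openT.
  split; first by apply/convex_setP.
  by exists z0.1; split => //; exists z0.2; rewrite -surjective_pairing.
have ge z : ((coupling z)%:E <= fitz T z)%E.
  have NI := locatable_locally_NI (identifiable_locatable idT).
  by have := NI _ gT z Logic.I; rewrite rT.
split; first by case: gT => _ [].
exists (fitz T); split.
  split.
    split => [z|]; first by rewrite gt_eqF// (lt_le_trans _ (ge z))// ltNyr.
    by exists z0; rewrite lt_eqF// (le_lt_trans (fitz_monotone mT Tz0))// ltry.
  by split; [exact: fitz_convex | split; [exact: fitz_lsc | exact: ge]].
rewrite rT; apply/seteqP; split => [z [/= zE _]|z Tz].
  by apply: (idT _ gT); rewrite rT /= zE; split.
by split => //=; apply/le_anti/andP; split; [exact: fitz_monotone | exact: ge].
Qed.

End LocalNI.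

Theorem theorem3p7 (R : realType) (X : tvsType R)
  (Xhaus : hausdorff_space X) (Xnontriv : exists x : X, x != 0)
  (T : operator X) :
  let i := in_M T /\ identifiable T in
  let ii := representable T /\ locatable T in
  let iii := representable T /\ locally_NI T in
  let iv := in_M T /\ low_representable T /\ locatable T in
  let v := in_M T /\ low_representable T /\ locally_NI T in
  (i <-> ii) /\ (i <-> iii) /\ (i <-> iv) /\ (i <-> v).
Proof.
move=> i ii iii iv v.
(* The implications form the cycle i, ii, iii, v, i, with iv on a second path from ii to v. *)
have i_ii : i -> ii.
  move=> [MT idT]; split; first exact: identifiable_representable.
  exact: identifiable_locatable.
have ii_iii : ii -> iii by move=> [rT /locatable_locally_NI].
have ii_iv : ii -> iv.
  move=> [rT locT]; split; first exact: representable_in_M.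
  by split => //; exact: representable_low_representable.
have iv_v : iv -> v by move=> [MT [lowT /locatable_locally_NI]].
have iii_v : iii -> v.
  move=> [rT NI]; split; first exact: representable_in_M.
  by split => //; exact: representable_low_representable.
have v_i : v -> i.
  move=> [MT [lowT NI]]; split => //.
  by apply: low_representable_locally_NI_identifiable => //; case: MT.
by split; [|split; [|split]]; split; auto.
Qed.
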